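(* Let $G,R,\epsilon>0$ with $n=\lfloor 0.9(GR/\epsilon)^2\rfloor\ge 1$, and for $z\in\{-1,+1\}^n$ let $F_z:\mathbb{R}^n\to\mathbb{R}$, $F_z(x)=G\max_{i\in[n]} z_ix_i$ (the family used in the classical lower bound). There is a quantum algorithm that, given quantum oracle access to the function value $F_z$ for an unknown $z\in\{-1,+1\}^n$, with high probability outputs $x\in B(\vec 0,R)$ with $F_z(x)-\min_{y\in B(\vec 0,R)}F_z(y)\le\epsilon$, using $O(GR/\epsilon)$ queries to the oracle for $F_z$.
   Context: $B(\vec 0,R)$ is the Euclidean ball of radius $R$ around the origin. A quantum oracle for a function $f$ is the unitary $|x\rangle|y\rangle\mapsto|x\rangle|y\oplus f(x)\rangle$, where inputs and outputs are real numbers written with $b$ bits of precision each ($b$ arbitrary), and can be queried in superposition. Each $F_z$ is convex with Lipschitz constant $G$.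
   Formalization: The precision b is not fully arbitrary: the result is for all fixed-point formats with enough integer and fractional bits (threshold depending on G, R, ε, n), the query bound being independent of b; with too few bits, such as b=1, the oracle can be the same for every z and the claim fails. *)

(* Defs.v *)
From HB Require Import structures.
From mathcomp Require Import all_boot all_order all_algebra.
From mathcomp Require Import complex.
From mathcomp Require Import all_classical all_reals.

Set Implicit Arguments.
Unset Strict Implicit.
Unset Printing Implicit Defensive.

Import Order.TTheory GRing.Theory Num.Theory.
Local Open Scope ring_scope.

(** * Convex optimization *)

(* MathComp-Analysis equips row vectors with the sup norm, hence this
   separate definition. *)
Definition l2norm (K : realType) (n : nat) (x : 'rV[K]_n) : K :=
  Num.sqrt (\sum_i x 0 i ^+ 2).

Definition l2ball (K : realType) (n : nat) (R : K) : set 'rV[K]_n :=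
  [set x | l2norm x <= R]%classic.

Definition is_sign_vector (K : realType) (n : nat) (z : 'rV[K]_n) : Prop :=
  forall i, z 0 i = 1 \/ z 0 i = -1.

(* The dimension is a successor, so the maximum is over a nonempty family and
   can be started from the term of index 0. *)
Definition Fmax (K : realType) (n : nat) (G : K) (z x : 'rV[K]_n.+1) : K :=
  G * \big[Num.max/z 0 0 * x 0 0]_i (z 0 i * x 0 i).

Definition is_minimum_on (T : Type) (K : realType) (A : set T) (f : T -> K)
    (m : K) : Prop :=
  (exists2 y, A y & f y = m) /\ (forall y, A y -> m <= f y).

Definition eps_optimal_on (T : Type) (K : realType) (A : set T) (f : T -> K)
    (eps : K) (x : T) : Prop :=
  A x /\ exists2 m, is_minimum_on A f m & f x - m <= eps.

(** * Real numbers on finitely many bits *)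

Definition bits (b : nat) := {ffun 'I_b -> bool}.

Definition xor_bits (b : nat) (v w : bits b) : bits b :=
  [ffun i => v i (+) w i].

(* Fixed-point sign-magnitude format on b = (p + q).+1 bits: bit 0 is the sign
   and bit j.+1 has weight 2 ^ (j - q), so that there are p integer bits and q
   fractional bits. *)
Definition real_of_bits (K : realType) (p q : nat) (w : bits (p + q).+1) : K :=
  (-1) ^+ w ord0 *
    ((\sum_(j < p + q) w (lift ord0 j) * 2 ^ j)%N%:R / 2 ^+ q).

(* Truncation of v to the format above, saturating at the largest representable
   magnitude. *)
Definition bits_of_real (K : realType) (p q : nat) (v : K) : bits (p + q).+1 :=
  let m := minn (Num.truncn (`|v| * 2 ^+ q)) (2 ^ (p + q)).-1 in
  [ffun i => if unlift ord0 i is Some j then odd (m %/ 2 ^ j) else v < 0].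

Definition bitsvec (n p q : nat) := {ffun 'I_n -> bits (p + q).+1}.

Definition vec_of_bits (K : realType) (n p q : nat) (x : bitsvec n p q) :
    'rV[K]_n :=
  \row_i real_of_bits K (x i).

Definition discretize (K : realType) (n p q : nat) (f : 'rV[K]_n -> K)
    (x : bitsvec n p q) : bits (p + q).+1 :=
  bits_of_real p q (f (vec_of_bits K x)).

(** * Quantum query algorithms *)

(* Computational basis |x>|y>|w> : query register, answer register, workspace. *)
Definition qbasis (X : finType) (b : nat) (W : finType) : finType :=
  (X * bits b * W)%type.

Definition qstate (K : realType) (B : finType) := 'cV[K[i]]_#|B|.

Definition ket (K : realType) (B : finType) (s : B) : qstate K B :=
  delta_mx (enum_rank s) 0.

Definition oracle_map (X : finType) (b : nat) (W : finType) (g : X -> bits b)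
    (s : qbasis X b W) : qbasis X b W :=
  let: (x, y, w) := s in (x, xor_bits y (g x), w).

(* The unitary |x>|y>|w> |-> |x>|y (+) g x>|w>, acting on column vectors. *)
Definition oracle_mx (K : realType) (X : finType) (b : nat) (W : finType)
    (g : X -> bits b) : 'M[K[i]]_#|qbasis X b W| :=
  \matrix_(s, t) (enum_val s == oracle_map g (enum_val t))%:R.

(* The gates do not depend on the oracle; the unknown function enters a run
   only through the oracle calls made between consecutive gates. *)
Record query_algorithm (K : realType) (X : finType) (b : nat) (Out : Type) :=
  QueryAlgorithm {
    qa_work : finType;
    qa_queries : nat;
    qa_init : qbasis X b qa_work;
    qa_gate : nat -> 'M[K[i]]_#|qbasis X b qa_work|;
    qa_gate_unitary : forall t, qa_gate t \is unitarymx;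
    qa_output : qbasis X b qa_work -> Out
  }.

Fixpoint qa_run (K : realType) (X : finType) (b : nat) (Out : Type)
    (A : query_algorithm K X b Out) (g : X -> bits b) (t : nat) :
    qstate K (qbasis X b (qa_work A)) :=
  if t is t'.+1
  then qa_gate A t *m (oracle_mx K (qa_work A) g *m qa_run A g t')
  else qa_gate A 0 *m ket K (qa_init A).

Definition qa_final (K : realType) (X : finType) (b : nat) (Out : Type)
    (A : query_algorithm K X b Out) (g : X -> bits b) :
    qstate K (qbasis X b (qa_work A)) :=
  qa_run A g (qa_queries A).

(* Born rule for a measurement in the computational basis. *)
Definition qa_prob (K : realType) (X : finType) (b : nat) (Out : Type)
    (A : query_algorithm K X b Out) (g : X -> bits b) (P : Out -> Prop) : K :=
  \sum_(s : qbasis X b (qa_work A) | `[< P (qa_output s) >])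
    Normc.normc (qa_final A g (enum_rank s) 0) ^+ 2.

(* Main.v *)
(* Write z as the set u of its positive coordinates. For S included
   in T, evaluating F_z at x = -1 on S, 1 on T \ S, 0 off T gives G, unless
   u /\ T = S, in which case the value is at most 0 and depends only on T: one
   query tests the guess S for the restriction of u to T.

   Let v_u be the vector indexed by the pairs (T, S) with entry a_|T| if
   S = u /\ T, b_|T| if S differs from u /\ T in exactly one coordinate, and 0
   otherwise. For u <> w, the inner product of v_u and v_w over the queries that
   distinguish u from w is the sum of 2 a_|T| b_|T| over the T containing exactly
   one coordinate where u and w differ. It equals 1 for
   2 a_L b_L = (L-1)! (N-L)! / N!: this is the probability that the first
   differing coordinate of a uniformly random ordering completes the prefix T.
   Balancing a_L against b_L gives |v_u|^2 = sum_{L <= N} L^(-1/2) <= 2 sqrt N.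

   Such a feasible point of the dual adversary bound yields an algorithm with Q
   queries and error O(|v_u| / sqrt Q) (the "catalyst" method of Belovs and
   Yolcu): with the catalyst v_u / sqrt Q available, the states
   sqrt(1-t/Q)|idle> + sqrt(t/Q)|u> + v_u / sqrt Q for successive t are related
   by one query followed by a unitary independent of u, because their Gram
   matrices agree; starting without the catalyst costs only its norm. Once u is
   known, the exact minimiser -(R / sqrt N) z is output. *)
Require Import Defs.
From mathcomp Require Import all_boot all_order all_algebra.
From mathcomp Require Import complex.
From mathcomp Require Import all_classical all_reals.
From mathcomp Require Import ring lra zify.
From mathcomp Require Import fintype finset.

Import Order.TTheory GRing.Theory Num.Theory.
Local Open Scope ring_scope.

Set Implicit Arguments.
Unset Strict Implicit.
Unset Printing Implicit Defensive.

(** * Catalytic query algorithms *)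

Section QueryAlgorithms.
Local Open Scope sesquilinear_scope.
Local Open Scope complex_scope.

(** * Vectors with equal Gram matrices are related by a unitary *)

Lemma mulmx_trmxC_eq0 (C : numClosedFieldType) (m n : nat) (X : 'M[C]_(m, n)) :
  X *m X^t* = 0 -> X = 0.
Proof.
move=> XX0; apply/row_matrixP => i; rewrite row0; apply/eqP.
rewrite -(dnorm_eq0 (@dotmx C n)); apply/eqP/(etrans (dotmxE _ _)).
have -> : row i X *m (row i X)^t* = row i (X *m X^t*) *m (delta_mx 0 i)^T.
  by rewrite !rowE trmx_mul map_mxM !mulmxA trmx_delta map_delta_mx.
by rewrite XX0 row0 mul0mx mxE.
Qed.

(** Gram-Schmidt on a basis of the orthogonal complement of the rows of [Q] supplies the missing
    [n - r] rows. *)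
Lemma unitarymx_extend (C : numClosedFieldType) (r n : nat) (Q : 'M[C]_(r, n)) :
  Q \is unitarymx -> exists S : 'M[C]_(n - r, n), col_mx Q S \is unitarymx.
Proof.
move=> QU; pose O := orthomx Num.conj (hermitian1mx n) Q.
have rkO : \rank O = (n - r)%N by rewrite rank_ortho mxrank_unitary.
move: (\rank O) rkO (row_base O) (eq_row_base O) (row_base_free O) => k kE O' O'E O'f.
subst k.
exists (schmidt O').
have SU : schmidt O' \is unitarymx by rewrite schmidt_unitarymx // leq_subr.
have QS : schmidt O' *m Q^t* = 0.
  apply/orthomx1P; rewrite eqmx_schmidt_free // O'E.
  exact: submx_refl.
apply/unitarymxP; rewrite tr_col_mx map_row_mx mul_col_row QS.
have -> : Q *m (schmidt O')^t* = 0.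
  have /(congr1 (fun M : 'M_(_, _) => M^t*)) := QS.
  rewrite trmx_mul map_mxM trmxCK => ->.
  by rewrite trmx0 map_mx0.
by rewrite (unitarymxP QU) (unitarymxP SU) -scalar_mx_block.
Qed.

(** Equal Gram matrices force equal linear dependencies between rows. An orthonormal basis
    [Q = M *m A] of the row space of [A] therefore has an orthonormal counterpart [Q' = M *m B];
    completing both to unitaries gives the change of basis [U]. *)
Lemma gram_unitary (C : numClosedFieldType) (m n : nat) (A B : 'M[C]_(m, n)) :
  A *m A^t* = B *m B^t* ->
  exists2 U : 'M[C]_n, U \is unitarymx & A *m U = B.
Proof.
move=> AB.
have [r [Q [rn QU AQ QA]]] : exists r, exists Q : 'M[C]_(r, n),
    [/\ (r <= n)%N, Q \is unitarymx, (A <= Q)%MS & (Q <= A)%MS].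
  exists (\rank A), (schmidt (row_base A)).
  rewrite rank_leq_col schmidt_unitarymx ?rank_leq_col //.
  by split; rewrite // eqmx_schmidt_free ?row_base_free // eq_row_base.
have /submxP[L AE] := AQ; have /submxP[M QE] := QA.
pose Q' := M *m B.
have Q'U : Q' \is unitarymx.
  apply/unitarymxP; rewrite /Q' trmx_mul map_mxM mulmxA -[M *m B *m _]mulmxA -AB.
  by rewrite -(unitarymxP QU) [in RHS]QE trmx_mul map_mxM !mulmxA.
(* The difference is [(1%:M - L *m M) *m B], whose Gram matrix is that of
   [(1%:M - L *m M) *m A = A - L *m Q = 0]. *)
have BE : B = L *m Q'.
  apply/eqP; rewrite -subr_eq0; apply/eqP/mulmx_trmxC_eq0.
  have -> : B - L *m Q' = (1%:M - L *m M) *m B.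
    by rewrite mulmxBl mul1mx -mulmxA.
  rewrite trmx_mul map_mxM mulmxA -[_ *m B *m _]mulmxA -AB mulmxA.
  by rewrite mulmxBl mul1mx -[L *m M *m A]mulmxA -QE -AE subrr !mul0mx.
have [S SU] := unitarymx_extend QU; have [S' S'U] := unitarymx_extend Q'U.
exists ((col_mx Q S)^t* *m col_mx Q' S').
  apply/unitarymxP; rewrite trmx_mul map_mxM trmxCK mulmxA.
  rewrite -[_ *m col_mx Q' S' *m _]mulmxA (unitarymxP S'U) mulmx1.
  by rewrite -[X in X *m _]mul1mx mulmxKtV ?subnKC.
rewrite {1}AE mulmxA.
have -> : L *m Q *m (col_mx Q S)^t* = L *m row_mx 1%:M 0.
  have := unitarymxP SU; rewrite -mulmxA mul_col_mx => /(congr1 usubmx).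
  by rewrite col_mxKu => ->; rewrite scalar_mx_block /block_mx col_mxKu.
by rewrite -mulmxA mul_row_col mul1mx mul0mx addr0.
Qed.

(** * The oracle as a permutation, norms, and labelled states *)

Lemma oracle_mapK (X : finType) (b : nat) (W : finType) (g : X -> bits b) :
  involutive (@oracle_map X b W g).
Proof.
move=> [[x y] w] /=; congr (_, _, _).
by apply/ffunP => i; rewrite !ffunE addbK.
Qed.

Lemma oracle_mxE (K : realType) (X : finType) (b : nat) (W : finType)
    (g : X -> bits b) (i j : 'I_#|qbasis X b W|) :
  oracle_mx K W g i j = (j == enum_rank (oracle_map g (enum_val i)))%:R.
Proof.
rewrite mxE -(inj_eq enum_val_inj j) enum_rankK eq_sym.
by rewrite (can2_eq (@oracle_mapK _ _ _ g) (@oracle_mapK _ _ _ g)).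
Qed.

Lemma oracle_mx_mul (K : realType) (X : finType) (b : nat) (W : finType)
    (g : X -> bits b) (n : nat) (M : 'M[K[i]]_(#|qbasis X b W|, n)) i j :
  (oracle_mx K W g *m M) i j = M (enum_rank (oracle_map g (enum_val i))) j.
Proof.
rewrite mxE (bigD1 (enum_rank (oracle_map g (enum_val i)))) //=.
rewrite oracle_mxE eqxx mul1r big1 ?addr0 // => k /negPf nk.
by rewrite oracle_mxE nk mul0r.
Qed.

Lemma oracle_unitary (K : realType) (X : finType) (b : nat) (W : finType)
    (g : X -> bits b) : oracle_mx K W g \is unitarymx.
Proof.
apply/unitarymxP/matrixP => i j; rewrite oracle_mx_mul !mxE enum_rankK.
by rewrite rmorph_nat oracle_mapK (inj_eq enum_val_inj) eq_sym.
Qed.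

Definition sqnorm (K : realType) (n : nat) (x : 'cV[K[i]]_n) : K :=
  \sum_i Normc.normc (x i 0) ^+ 2.

Lemma sqnormE (K : realType) (n : nat) (x : 'cV[K[i]]_n) :
  (sqnorm x)%:C = (x^t* *m x) 0 0.
Proof.
rewrite rmorph_sum mxE; apply: eq_bigr => i _.
by rewrite !mxE -normCKC rmorphXn.
Qed.

Lemma sqnorm_unitary (K : realType) (n : nat) (U : 'M[K[i]]_n) (x : 'cV[K[i]]_n) :
  U \is unitarymx -> sqnorm (U *m x) = sqnorm x.
Proof.
rewrite -trmxC_unitary => /unitarymxP; rewrite trmxCK => UU.
apply: complexI; rewrite !sqnormE trmx_mul map_mxM mulmxA.
by rewrite -[_ *m U]mulmxA UU mulmx1.
Qed.

Lemma sqnormN (K : realType) (n : nat) (x : 'cV[K[i]]_n) : sqnorm (- x) = sqnorm x.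
Proof.
by apply: eq_bigr => i _; rewrite mxE; case: (x i 0) => u v /=; rewrite !sqrrN.
Qed.

Lemma conjC_real_complex (K : realType) (r : K) :
  Num.conj (r%:C : K[i]) = r%:C.
Proof. exact: conjc_real. Qed.

(* The workspace holds the label w of the term a w |iota w>, so terms with
   different labels are orthogonal whatever the oracle does. *)
Definition labelled_state (K : realType) (X : finType) (b : nat) (W : finType)
    (iota : W -> qbasis X b W) (a : W -> K) : qstate K (qbasis X b W) :=
  \col_k ((iota (enum_val k).2 == enum_val k)%:R * a (enum_val k).2)%:C.

Lemma oracle_labelled_state (K : realType) (X : finType) (b : nat) (W : finType)
    (g : X -> bits b) (iota : W -> qbasis X b W) (a : W -> K) :
  oracle_mx K W g *m labelled_state iota a = labelled_state (oracle_map g \o iota) a.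
Proof.
apply/colP => k; rewrite oracle_mx_mul !mxE enum_rankK.
have -> : (oracle_map g (enum_val k)).2 = (enum_val k).2.
  by case: (enum_val k) => [[]].
by rewrite /= (can2_eq (@oracle_mapK _ _ _ g) (@oracle_mapK _ _ _ g)).
Qed.

(** Among the basis states with label [w], only [iota w] and [kappa w] carry amplitude, so the label
    contributes exactly when these coincide. *)
Lemma labelled_state_dot (K : realType) (X : finType) (b : nat) (W : finType)
    (iota kappa : W -> qbasis X b W) (a c : W -> K) :
  (forall w, (iota w).2 = w) ->
  \sum_k labelled_state iota a k 0 * Num.conj (labelled_state kappa c k 0) =
  (\sum_(w | iota w == kappa w) a w * c w)%:C.
Proof.
move=> iotaW; rewrite rmorph_sum /=.
transitivity (\sum_(s : qbasis X b W)
   ((iota s.2 == s)%:R * a s.2 * ((kappa s.2 == s)%:R * c s.2))%:C).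
  rewrite (reindex enum_rank) /=; last by apply: onW_bij; exact: enum_rank_bij.
  by apply: eq_bigr => s _; rewrite !mxE enum_rankK conjC_real_complex -rmorphM.
rewrite (partition_big (fun s : qbasis X b W => s.2) xpredT) //= [RHS]big_mkcond.
apply: eq_bigr => w _.
rewrite (bigD1 (iota w)) ?iotaW //= eqxx big1 ?addr0.
  by rewrite eq_sym mul1r; case: eqP => _; rewrite ?mul1r // mul0r mulr0.
move=> s /andP[/eqP sw sn]; rewrite sw.
by rewrite eq_sym (negPf sn) !mul0r.
Qed.

Lemma sqnorm_labelled_state (K : realType) (X : finType) (b : nat) (W : finType)
    (iota : W -> qbasis X b W) (a : W -> K) :
  (forall w, (iota w).2 = w) -> sqnorm (labelled_state iota a) = \sum_w a w ^+ 2.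
Proof.
move=> iotaW; apply: complexI.
rewrite (eq_bigl (fun w => iota w == iota w)); last by move=> w; rewrite eqxx.
rewrite -labelled_state_dot // rmorph_sum; apply: eq_bigr => k _.
by rewrite -normCK rmorphXn.
Qed.

Lemma gram_labelled_state (K : realType) (X : finType) (b : nat) (W Z : finType)
    (iota kappa : Z -> W -> qbasis X b W) (a c : Z -> W -> K) :
  (forall z w, (iota z w).2 = w) -> (forall z w, (kappa z w).2 = w) ->
  (forall z z', \sum_(w | iota z w == iota z' w) a z w * a z' w =
                \sum_(w | kappa z w == kappa z' w) c z w * c z' w) ->
  exists2 V : 'M[K[i]]_#|qbasis X b W|, V \is unitarymx &
    forall z, V *m labelled_state (iota z) (a z) = labelled_state (kappa z) (c z).
Proof.
move=> iotaW kappaW Hac.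
pose A := \matrix_(r < #|Z|) (labelled_state (iota (enum_val r)) (a (enum_val r)))^T.
pose B := \matrix_(r < #|Z|) (labelled_state (kappa (enum_val r)) (c (enum_val r)))^T.
have [|U UU AU] := @gram_unitary _ _ _ A B.
  apply/matrixP => r r'.
  pose z := enum_val r; pose z' := enum_val r'.
  transitivity (\sum_k labelled_state (iota z) (a z) k 0 *
                Num.conj (labelled_state (iota z') (a z') k 0)).
    by rewrite mxE; apply: eq_bigr => k _; rewrite !mxE.
  rewrite labelled_state_dot // Hac -labelled_state_dot //.
  by rewrite [RHS]mxE; apply: eq_bigr => k _; rewrite !mxE.
exists U^T; first by rewrite trmx_unitary.
move=> z; apply: trmx_inj; rewrite trmx_mul trmxK.
have := congr1 (row (enum_rank z)) AU.
by rewrite row_mul !rowK enum_rankK.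
Qed.

(** * Exact evolution in the presence of a catalyst, and the cost of omitting it *)

Section Catalyst.
Variables (K : realType) (X Y Z : finType) (b : nat).
Variables (x0 : X) (e : Y -> X) (g : Z -> X -> bits b) (v : Z -> Y -> K).
Variable T : nat.
Hypothesis T_gt0 : (0 < T)%N.
Hypothesis g0 : forall z, g z x0 = [ffun=> false].
Hypothesis v_adv : forall z w,
  \sum_(y | g z (e y) != g w (e y)) v z y * v w y = (z != w)%:R.

Let W : finType := (unit + Z + Y)%type.

(** Only catalyst labels make a genuine query. The idle label and the answer labels query [x0],
    where every oracle returns zero bits, so an oracle call fixes them. *)
Definition catalyst_loc (w : W) : qbasis X b W :=
  (if w is inr y then e y else x0, [ffun=> false], w).

Definition catalyst_amp (t : nat) (z : Z) (w : W) : K :=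
  match w with
  | inl (inl _) => Num.sqrt (1 - t%:R / T%:R)
  | inl (inr z') => (z' == z)%:R * Num.sqrt (t%:R / T%:R)
  | inr y => v z y / Num.sqrt T%:R
  end.

Let T0 : (0 : K) < T%:R. Proof. by rewrite ltr0n. Qed.
Let Tneq0 : (T%:R : K) != 0. Proof. by rewrite gt_eqF. Qed.

Lemma catalyst_amp_dot (P : pred W) t z z' :
  (t <= T)%N -> (forall u, P (inl u)) ->
  \sum_(w | P w) catalyst_amp t z w * catalyst_amp t z' w =
  1 - t%:R / T%:R + (z == z')%:R * (t%:R / T%:R) +
  (\sum_(y | P (inr y)) v z y * v z' y) / T%:R.
Proof.
move=> tT Pinl; rewrite big_sumType /=; congr (_ + _); last first.
  rewrite mulr_suml; apply: eq_bigr => y _.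
  by rewrite mulrACA -invfM -expr2 sqr_sqrtr // ltW.
rewrite (eq_bigl xpredT) //= big_sumType /=; congr (_ + _).
  rewrite (big_pred1 tt) /=; last by case.
  rewrite -expr2 sqr_sqrtr // subr_ge0 ler_pdivrMr // mul1r ler_nat //.
rewrite (bigD1 z) //= eqxx mul1r big1 ?addr0; last first.
  by move=> u /negPf ->; rewrite !mul0r.
rewrite mulrCA -expr2 sqr_sqrtr //.
by rewrite divr_ge0.
Qed.

Lemma catalyst_oracle_eq z z' (w : W) :
  ((oracle_map (g z) \o catalyst_loc) w == (oracle_map (g z') \o catalyst_loc) w) =
  (if w is inr y then g z (e y) == g z' (e y) else true).
Proof.
have xor0 (k : bits b) : xor_bits [ffun=> false] k = k.
  by apply/ffunP => i; rewrite !ffunE.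
by case: w => [u|y]; rewrite /= !xor0 ?g0 !xpair_eqE !eqxx ?andbT.
Qed.

(** Both families have the same Gram matrix. The query removes from the catalyst overlap the
    distinguishing [y], worth [(z != z')%:R / T%:R] by [v_adv]. Going from [t] to [t.+1], the idle
    overlap loses [1 / T] and the answer overlap regains it only if [z = z']: the same net loss. *)
Lemma catalyst_step t : (t < T)%N ->
  exists2 V : 'M[K[i]]_#|qbasis X b W|, V \is unitarymx &
    forall z,
      V *m (oracle_mx K W (g z) *m labelled_state catalyst_loc (catalyst_amp t z)) =
      labelled_state catalyst_loc (catalyst_amp t.+1 z).
Proof.
move=> tT.
have [||z z'|V VU HV] := @gram_labelled_state K X b W Z
  (fun z => oracle_map (g z) \o catalyst_loc) (fun _ => catalyst_loc)
  (catalyst_amp t) (catalyst_amp t.+1).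
- by [].
- by [].
- rewrite (eq_bigl _ _ (catalyst_oracle_eq z z')).
  rewrite (eq_bigl xpredT _ (fun w => eqxx (catalyst_loc w))).
  rewrite !catalyst_amp_dot //=; last by rewrite ltnW.
  rewrite [X in _ = _ + X / _](bigID (fun y => g z (e y) == g z' (e y))) /= v_adv.
  by rewrite -natr1; case: (z == z') => /=; field.
- by exists V => // z; rewrite oracle_labelled_state HV.
Qed.

Lemma catalyst_algorithm (Out : Type) (out : Z -> Out) (out0 : Out) :
  exists A : query_algorithm K X b Out, qa_queries A = T /\
    forall z (P : Out -> Prop), P (out z) ->
    1 - 2 * Num.sqrt ((\sum_y v z y ^+ 2) / T%:R) <= qa_prob A (g z) P.
Proof.
have /choice[V HV] t : exists V : 'M[K[i]]_#|qbasis X b W|, V \is unitarymx /\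
    ((t < T)%N -> forall z,
    V *m (oracle_mx K W (g z) *m labelled_state catalyst_loc (catalyst_amp t z)) =
      labelled_state catalyst_loc (catalyst_amp t.+1 z)).
  have [tT|tT] := ltnP t T; last first.
    by exists 1%:M; split=> //; apply/unitarymxP; rewrite trmx1 map_mx1 mulmx1.
  by have [U UU HU] := catalyst_step tT; exists U.
pose gate t := if t is t'.+1 then V t' else 1%:M.
have gateU t : gate t \is unitarymx.
  case: t => [|t]; last by case: (HV t).
  by apply/unitarymxP; rewrite trmx1 map_mx1 mulmx1.
pose A := @QueryAlgorithm K X b Out W T (catalyst_loc (inl (inl tt))) gate gateU
  (fun s => if s.2 is inl (inr z) then out z else out0).
exists A; split => // z P Pz.
(* The actual run and the ideal one undergo the same unitaries, so their distance stays what it is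
   at time 0, namely the norm of the absent catalyst. *)
have err t : (t <= T)%N ->
    sqnorm (qa_run A (g z) t - labelled_state catalyst_loc (catalyst_amp t z)) =
    (\sum_y v z y ^+ 2) / T%:R.
  elim: t => [_|t IH tT]; last first.
    have [VU /(_ tT) /(_ z) <-] := HV t.
    rewrite /= -/(gate t.+1) -mulmxBr -mulmxBr !sqnorm_unitary ?oracle_unitary //.
    by rewrite IH // ltnW.
  rewrite /= mul1mx.
  have -> : ket K (qa_init A) - labelled_state catalyst_loc (catalyst_amp 0 z) =
    - labelled_state catalyst_loc
        (fun w => if w is inr y then v z y / Num.sqrt T%:R else 0).
    apply/colP => k; rewrite !mxE /= eqxx andbT -[k in k == _]enum_valK.
    rewrite (inj_eq enum_rank_inj).
    case: (enum_val k) => [[x y] [[[]|z']|q]] /=.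
    - rewrite eq_sym mul0r subr0 sqrtr1 mulr1 mulr0 oppr0 rmorph_nat.
      by rewrite subrr.
    - rewrite mul0r sqrtr0 !mulr0 [_ == catalyst_loc _]xpair_eqE andbF.
      by rewrite oppr0 addr0.
    - by rewrite [_ == catalyst_loc (inl _)]xpair_eqE andbF sub0r.
  rewrite sqnormN sqnorm_labelled_state // big_sumType /= big1 ?add0r => [|u _];
    last by rewrite expr0n.
  rewrite mulr_suml; apply: eq_bigr => y _.
  by rewrite expr_div_n sqr_sqrtr // ltW.
have {err} := err T (leqnn T).
set psi := qa_run A (g z) T; set phi := labelled_state _ _; set eta := _ / _ => err.
pose s := catalyst_loc (inl (inr z)).
pose d := (psi - phi) (enum_rank s) 0.
(* At time [T] all the weight of the idle label has moved to the correct answer. *)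
have phis : phi (enum_rank s) 0 = 1.
  by rewrite mxE enum_rankK /s /= !eqxx !mul1r divff // sqrtr1.
have dE : Normc.normc d ^+ 2 <= eta.
  rewrite -err /sqnorm (bigD1 (enum_rank s)) //= lerDl sumr_ge0 // => k _.
  by rewrite sqr_ge0.
have normcE (c : K[i]) : (Normc.normc c)%:C = `|c| by case: c.
have norm0 (c : K[i]) : 0 <= Normc.normc c by case: c => * /=; rewrite sqrtr_ge0.
have dle : Normc.normc d <= Num.sqrt eta.
  by rewrite -[X in X <= _]ger0_norm ?norm0 // -sqrtr_sqr ler_wsqrtr.
have psis : 1 <= Normc.normc (psi (enum_rank s) 0) + Normc.normc d.
  rewrite -lecR rmorphD /= !normcE -[d]opprK normrN.
  apply: le_trans (ler_normD _ _).
  have -> : d = psi (enum_rank s) 0 - 1 by rewrite /d mxE [X in _ + X]mxE phis.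
  by rewrite opprB addrC subrK normr1.
have psi2 : Normc.normc (psi (enum_rank s) 0) ^+ 2 <= qa_prob A (g z) P.
  rewrite /qa_prob (bigD1 s) /=; last by apply/asboolP.
  by rewrite lerDl sumr_ge0 // => k _; rewrite sqr_ge0.
apply: le_trans psi2.
(* The modulus [m] of the amplitude is at least [1 - Num.sqrt eta], and [m ^+ 2 >= 2 * m - 1]. *)
by have := norm0 (psi (enum_rank s) 0); nra.
Qed.

End Catalyst.

End QueryAlgorithms.

(** * A feasible point of the dual adversary bound *)

Lemma sum_subsets_card (R : nmodType) (I : finType) (U : {set I}) (f : nat -> R) :
  \sum_(A : {set I} | A \subset U) f #|A| = \sum_(k < #|U|.+1) f k *+ 'C(#|U|, k).
Proof.
rewrite (partition_big (fun A : {set I} => inord #|A| : 'I_#|U|.+1) xpredT) //=.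
apply: eq_bigr => k _.
have kA (A : {set I}) : A \subset U -> (inord #|A| == k) = (#|A| == k).
  by move=> AU; rewrite -val_eqE /= inordK // ltnS subset_leq_card.
rewrite -cards_draws -sumr_const; apply: eq_big => [A|A /andP[AU]].
  by rewrite inE; case: (boolP (A \subset U)) => //= /kA.
by rewrite kA // => /eqP ->.
Qed.

(* The Beta integral of r^l (1-r)^m over [0, 1]. *)
Definition beta_weight (K : realType) (l m : nat) : K :=
  (l`! * m`!)%:R / (l + m).+1`!%:R.

(** Under the integral this is r + (1-r) = 1. *)
Lemma beta_weightD (K : realType) (l m : nat) :
  beta_weight K l.+1 m + beta_weight K l m.+1 = beta_weight K l m.
Proof.
rewrite /beta_weight addSn addnS !factS !natrM -!natr1 natrD.
have := fact_gt0 l; have := fact_gt0 m; have := fact_gt0 (l + m).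
rewrite -!(ltr0n K) => *; field.
have := ler0n K l; have := ler0n K m => *.
apply/andP; split; [|apply/andP; split]; rewrite gt_eqF //; lra.
Qed.

Lemma sum_binS (R : nmodType) (u : nat) (f : nat -> R) :
  \sum_(k < u.+2) f k *+ 'C(u.+1, k) =
  \sum_(k < u.+1) (f k + f k.+1) *+ 'C(u, k).
Proof.
under [RHS]eq_bigr => k _ do rewrite mulrnDl.
rewrite big_split /= big_ord_recl /=.
under eq_bigr => k _ do rewrite /bump /= add1n binS mulrnDr.
rewrite big_split /= addrA; congr (_ + _).
transitivity (\sum_(k < u.+2) f k *+ 'C(u, k)).
  by rewrite [RHS]big_ord_recl /= !bin0.
by rewrite big_ord_recr /= bin_small // mulr0n addr0.
Qed.

(** This integrates the binomial expansion of (r + (1-r))^u = 1 against r^l (1-r)^m; the induction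
    peels off one factor by Pascal's rule. *)
Lemma beta_weight_sum (K : realType) (u l m : nat) :
  \sum_(k < u.+1) beta_weight K (k + l) (u - k + m) *+ 'C(u, k) = beta_weight K l m.
Proof.
elim: u => [|u IH]; first by rewrite big_ord1 bin0.
rewrite -IH (sum_binS u (fun k => beta_weight K (k + l) (u.+1 - k + m))).
apply: eq_bigr => k _; congr (_ *+ _).
by rewrite subSS addSn subSn -1?ltnS // addSn addrC beta_weightD.
Qed.

(** * Symmetric differences *)

Definition symdiff (I : finType) (A B : {set I}) := (A :\: B) :|: (B :\: A).

Lemma in_symdiff (I : finType) (A B : {set I}) i :
  (i \in symdiff A B) = (i \in A) (+) (i \in B).
Proof. by rewrite !inE; case: (i \in A); case: (i \in B). Qed.

Lemma symdiffC (I : finType) (A B : {set I}) : symdiff A B = symdiff B A.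
Proof. by apply/setP => i; rewrite !in_symdiff addbC. Qed.

Lemma symdiffK (I : finType) (A : {set I}) : involutive (symdiff A).
Proof. by move=> B; apply/setP => i; rewrite !in_symdiff addKb. Qed.

Lemma card_symdiff_eq0 (I : finType) (A B : {set I}) :
  (#|symdiff A B| == 0%N) = (A == B).
Proof.
rewrite cards_eq0; apply/eqP/eqP => [/setP AB|->]; apply/setP => i.
  by have := AB i; rewrite in_symdiff in_set0; case: (i \in A); case: (i \in B).
by rewrite in_symdiff in_set0 addbb.
Qed.

Lemma symdiffIr (I : finType) (A B T : {set I}) :
  symdiff (A :&: T) (B :&: T) = symdiff A B :&: T.
Proof.
apply/setP => i; rewrite in_setI !in_symdiff !in_setI.
by case: (i \in A); case: (i \in B); case: (i \in T).
Qed.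

Lemma symdiff_sub (I : finType) (A B T : {set I}) : A \subset T ->
  (symdiff A B \subset T) = (B \subset T).
Proof.
move=> AT; apply/idP/idP => [ABT|BT]; last first.
  by rewrite subUset !(subset_trans (subsetDl _ _)).
rewrite -[B](symdiffK A) subUset !(subset_trans (subsetDl _ _)) //.
Qed.

Lemma sum_inv_sqrt_le (K : realType) (n : nat) :
  \sum_(k < n) (Num.sqrt k.+1%:R)^-1 <= 2 * Num.sqrt n%:R :> K.
Proof.
elim: n => [|n IH]; first by rewrite big_ord0 sqrtr0 mulr0.
rewrite big_ord_recr /=; apply: le_trans (lerD IH (lexx _)) _.
have s0 : 0 <= Num.sqrt n%:R :> K by rewrite sqrtr_ge0.
have t0 : 0 < Num.sqrt n.+1%:R :> K by rewrite sqrtr_gt0 ltr0n.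
have ss : Num.sqrt n%:R ^+ 2 = n%:R :> K by rewrite sqr_sqrtr.
have tt' : Num.sqrt n.+1%:R ^+ 2 = n%:R + 1 :> K by rewrite sqr_sqrtr // natr1.
move: (Num.sqrt n%:R : K) (Num.sqrt n.+1%:R : K) s0 t0 ss tt' => s t s0 t0 ss tt'.
(* The increment satisfies 1/t <= 2(t-s): since t^2 - s^2 = 1, the difference 2t(t-s) - 1 is
   (t-s)^2. *)
by rewrite -lerBrDl -[t^-1]mul1r ler_pdivrMr //; nra.
Qed.

(** * The adversary vectors: norm and inner products *)

Section Witness.
Variables (K : realType) (n : nat).
Local Notation I := 'I_n.

(** For [0 < L <= n] this is (L-1)! (n-L)! / n!. At [L = 0] the truncated predecessor yields
    1/(n+1), a value that the factor [Num.sqrt L%:R] in [hit_amp] turns into 0. *)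
Definition shell_weight (L : nat) : K := beta_weight K L.-1 (n - L).

(* Summing over the coordinate i at which T meets D leaves the subsets of the
   complement of D, over which the Beta weights add up to 1 / #|D|. *)
Lemma shell_weight_sum (D : {set I}) : (0 < #|D|)%N ->
  \sum_(T : {set I} | #|D :&: T| == 1%N) shell_weight #|T| = 1.
Proof.
move=> D_gt0.
have DC : (#|D| + #|~: D| = n)%N by rewrite cardsC card_ord.
have one (i : I) : i \in D ->
    \sum_(T : {set I} | D :&: T == [set i]) shell_weight #|T| = beta_weight K 0 #|D|.-1.
  move=> iD; rewrite -(beta_weight_sum K #|~: D|).
  rewrite -(sum_subsets_card (~: D)
    (fun k => beta_weight K (k + 0) (#|~: D| - k + #|D|.-1))).
  (* A set meeting [D] exactly in [i] is [i |: U] with [U] outside [D]. *)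
  rewrite (reindex_onto (fun U => i |: U) (fun T => T :\: D)) /=; last first.
    move=> T /eqP DT; apply/setP => j; rewrite !inE.
    have := congr1 (fun A : {set I} => j \in A) DT; rewrite !inE.
    by case: (j \in D) => //= [<-|<-]; rewrite ?orbF.
  apply: eq_big => [U|U].
    apply/andP/idP => [[_ /eqP <-]|UD]; first by rewrite subsetDr.
    have Uout j : (j \in U) ==> (j \notin D).
      by apply/implyP => /(subsetP UD); rewrite inE.
    have Di j : (j == i) ==> (j \in D) by apply/implyP => /eqP ->.
    split; apply/eqP/setP => j; move: (Uout j) (Di j); rewrite !inE;
      by case: (j \in U); case: (j \in D); case: (j == i).
  move=> /andP[_ /eqP UE].
  have iU : i \notin U by rewrite -UE !inE iD.
  have UD : (#|U| <= #|~: D|)%N.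
    by rewrite subset_leq_card // -UE subsetDr.
  rewrite /shell_weight cardsU1 iU addn0 /= add1n /=; congr beta_weight.
  by move: #|U| #|~: D| #|D| DC D_gt0 UD => u c d; lia.
transitivity (\sum_(i in D) beta_weight K 0 #|D|.-1).
  under [RHS]eq_bigr => i iD do rewrite -(one i iD).
  rewrite (exchange_big_dep (fun T : {set I} => #|D :&: T| == 1%N)) /=; last first.
    by move=> i T _ /eqP ->; rewrite cards1.
  apply: eq_bigr => T /cards1P[i DT].
  have iD : i \in D by have := set11 i; rewrite -DT inE => /andP[].
  rewrite (big_pred1 i) // => j; rewrite DT.
  rewrite (inj_eq set1_inj) [RHS]eq_sym.
  by case: eqVneq => [<-|]; rewrite ?andbT ?andbF.
rewrite sumr_const /beta_weight fact0 mul1n add0n prednK // -mulr_natr.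
rewrite -{3}(prednK D_gt0) -{2}(prednK D_gt0) factS natrM prednK //.
have := fact_gt0 #|D|.-1; move: D_gt0; rewrite -!(ltr0n K) => d0 f0.
by field; rewrite !gt_eqF.
Qed.

Lemma shell_weight_bin (L : nat) : (0 < L <= n)%N ->
  shell_weight L *+ 'C(n, L) = L%:R^-1.
Proof.
case: L => // L Ln; rewrite /shell_weight /beta_weight /=.
have -> : ((L + (n - L.+1)).+1 = n)%N by lia.
have /(congr1 (fun k => k%:R : K)) := bin_fact Ln.
rewrite factS !natrM -mulr_natr => <-.
have := fact_gt0 L; have := fact_gt0 (n - L.+1).
have : (0 < 'C(n, L.+1))%N by rewrite bin_gt0.
have : (0 < L.+1)%N by [].
rewrite -!(ltr0n K) => *.
by field; rewrite ?gt_eqF // nat1r.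
Qed.

(** These are a_L and b_L. A set of size L has one correct guess and L guesses with a single error,
    so the norm sees a_L^2 + L b_L^2; for a prescribed product a_L b_L this is least when the two
    terms are equal. *)
Definition hit_amp (L : nat) : K := Num.sqrt (shell_weight L * Num.sqrt L%:R / 2).
Definition miss_amp (L : nat) : K := hit_amp L / Num.sqrt L%:R.

Definition witness (z : {set I}) (y : {set I} * {set I}) : K :=
  let E := symdiff (z :&: y.1) y.2 in
  if y.2 \subset y.1 then
    if #|E| == 0%N then hit_amp #|y.1| else if #|E| == 1%N then miss_amp #|y.1| else 0
  else 0.

Lemma shell_weight_ge0 L : 0 <= shell_weight L.
Proof. by rewrite /shell_weight /beta_weight divr_ge0. Qed.

Lemma hit_amp2 L : hit_amp L ^+ 2 = shell_weight L * Num.sqrt L%:R / 2.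
Proof.
by rewrite sqr_sqrtr // divr_ge0 // mulr_ge0 ?shell_weight_ge0 ?sqrtr_ge0.
Qed.

Lemma hit_ampb L : (0 < L)%N -> hit_amp L * miss_amp L = shell_weight L / 2.
Proof.
move=> L0; rewrite /miss_amp mulrA -expr2 hit_amp2.
by field; rewrite gt_eqF // sqrtr_gt0 ltr0n.
Qed.

Lemma miss_amp2 L : miss_amp L ^+ 2 *+ L = shell_weight L * Num.sqrt L%:R / 2.
Proof.
case: L => [|L]; first by rewrite mulr0n sqrtr0 mulr0 mul0r.
rewrite expr_div_n hit_amp2 sqr_sqrtr // -[in LHS]mulr_natr; field.
by rewrite nat1r pnatr_eq0.
Qed.

Lemma witness_norm (z : {set I}) :
  \sum_y witness z y ^+ 2 <= 2 * Num.sqrt n%:R.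
Proof.
pose f (T : {set I}) k : K := 
  (if k == 0%N then hit_amp #|T| else if k == 1%N then miss_amp #|T| else 0) ^+ 2.
have -> : \sum_y witness z y ^+ 2 =
    \sum_(T : {set I}) shell_weight #|T| * Num.sqrt #|T|%:R.
  rewrite -(pair_bigA _ (fun T S => witness z (T, S) ^+ 2)) /=.
  apply: eq_bigr => T _.
  transitivity (\sum_(S : {set I} | S \subset T) f T #|S|).
    (* Replacing [S] by its set of errors relative to [z :&: T] makes the sum independent of [z]. *)
    rewrite [RHS](reindex_inj (inv_inj (symdiffK (z :&: T)))) [RHS]big_mkcond /=.
    apply: eq_bigr => S _; rewrite /witness /= symdiff_sub ?subsetIr //.
    by case: ifP => // _; rewrite expr0n.
  (* For the empty set the only term is [hit_amp 0], which is 0. Otherwise the error counts 0 and 1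
     remain, with multiplicities 1 and [L.+1], and contribute equally. *)
  rewrite sum_subsets_card /f; case: #|T| => [|L].
    by rewrite big_ord1 /= bin0 hit_amp2 sqrtr0 !mulr0 mul0r.
  rewrite !big_ord_recl big1 /= => [|k _]; last by rewrite expr0n mul0rn.
  rewrite addr0 bin0 /bump /= addn0 bin1 hit_amp2 miss_amp2 mulr1n.
  by field.
have -> : \sum_(T : {set I}) shell_weight #|T| * Num.sqrt #|T|%:R =
    \sum_(k < n) (Num.sqrt k.+1%:R)^-1.
  rewrite (eq_bigl (fun T : {set I} => T \subset [set: I])) => [|T];
    last by rewrite subsetT.
  rewrite (sum_subsets_card [set: I] (fun k => shell_weight k * Num.sqrt k%:R)).
  rewrite cardsT card_ord big_ord_recl sqrtr0 mulr0 mul0rn add0r.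
  apply: eq_bigr => k _; rewrite /bump /= ?add1n mulrC -mulrnAr.
  rewrite shell_weight_bin ?ltn_ord //.
  have k0 : 0 < Num.sqrt k.+1%:R :> K by rewrite sqrtr_gt0 ltr0n.
  rewrite -[X in _ / X](@sqr_sqrtr K) // expr2 invfM mulrA divff ?mul1r //.
  by rewrite gt_eqF.
exact: sum_inv_sqrt_le.
Qed.

(** For fixed [T], a guess distinguishes [z] from [w] only if their restrictions to [T] differ and
    it equals one of them. Both such guesses then contribute [hit_amp * miss_amp] if the
    restrictions differ in one coordinate, and 0 otherwise; [shell_weight_sum] for [symdiff z w]
    adds this up. *)
Lemma witness_dot (z w : {set I}) (P : pred ({set I} * {set I})) :
  (forall y : {set I} * {set I}, y.2 \subset y.1 ->
    P y = ((z :&: y.1 == y.2) != (w :&: y.1 == y.2))) ->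
  \sum_(y | P y) witness z y * witness w y = (z != w)%:R.
Proof.
move=> HP.
have wit_self (u : {set I}) (T : {set I}) : witness u (T, u :&: T) = hit_amp #|T|.
  rewrite /witness /= subsetIr.
  by have := card_symdiff_eq0 (u :&: T) (u :&: T); rewrite eqxx => ->.
have wit_other (u u' T : {set I}) : u :&: T != u' :&: T ->
    witness u (T, u' :&: T) = (#|symdiff u u' :&: T| == 1%N)%:R * miss_amp #|T|.
  move=> uu'; rewrite /witness /= subsetIr card_symdiff_eq0 (negPf uu') symdiffIr.
  by case: ifP; rewrite ?mul1r ?mul0r.
have wit_S (T : {set I}) : \sum_(S | P (T, S)) witness z (T, S) * witness w (T, S) =
    (#|symdiff z w :&: T| == 1%N)%:R * shell_weight #|T|.
  case: (eqVneq (z :&: T) (w :&: T)) => [zw|zw].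
    rewrite -symdiffIr zw; have := card_symdiff_eq0 (w :&: T) (w :&: T).
    rewrite eqxx => /eqP ->; rewrite mul0r big1 // => S PS.
    case: (boolP (S \subset T)) => ST.
      by move: PS; rewrite (HP (T, S)) //= zw eqxx.
    by rewrite /witness /= (negPf ST) mul0r.
  rewrite (bigD1 (z :&: T)) /=; last first.
    by rewrite HP /= ?subsetIr // eqxx [w :&: T == _]eq_sym (negPf zw).
  rewrite (bigD1 (w :&: T)) /=; last first.
    by rewrite HP /= ?subsetIr // eqxx (negPf zw) [w :&: T == _]eq_sym (negPf zw).
  rewrite big1 ?addr0 => [|S /andP[/andP[PS Sz] Sw]]; last first.
    case: (boolP (S \subset T)) => ST.
      by move: PS; rewrite HP //= ![_ == S]eq_sym (negPf Sz) (negPf Sw).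
    by rewrite /witness /= (negPf ST) mul0r.
  rewrite !wit_self !wit_other // 1?eq_sym // [symdiff w z]symdiffC.
  case: (eqVneq #|symdiff z w :&: T| 1%N) => [c1|_]; last by rewrite !mul0r mulr0 addr0.
  have T0 : (0 < #|T|)%N.
    by rewrite (leq_trans _ (subset_leq_card (subsetIr (symdiff z w) T))) // c1.
  by rewrite !mul1r [_ * hit_amp _]mulrC hit_ampb // -splitr.
transitivity (\sum_(T : {set I}) \sum_(S | P (T, S))
                witness z (T, S) * witness w (T, S)).
  by rewrite pair_big_dep /=; apply: eq_big => -[].
under eq_bigr => T _ do rewrite wit_S.
have [->|zw] := eqVneq z w.
  rewrite big1 // => T _; rewrite -symdiffIr.
  have := card_symdiff_eq0 (w :&: T) (w :&: T).
  by rewrite eqxx => /eqP ->; rewrite mul0r.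
have D0 : (0 < #|symdiff z w|)%N by rewrite lt0n card_symdiff_eq0.
apply: etrans (shell_weight_sum D0); rewrite [RHS]big_mkcond.
by apply: eq_bigr => T _ /=; case: ifP; rewrite ?mul1r ?mul0r.
Qed.
End Witness.

(** * Guesses as queries to the maximum function *)

Definition sign_row (K : realType) (n : nat) (u : {set 'I_n}) : 'rV[K]_n :=
  \row_i (-1) ^+ (i \notin u).

Lemma sign_vectorP (K : realType) (n : nat) (z : 'rV[K]_n) :
  is_sign_vector z -> exists u, z = sign_row K u.
Proof.
move=> zS; exists [set i | z 0 i == 1]; apply/rowP => i; rewrite mxE inE.
by case: (zS i) => ->; rewrite ?eqxx // eqNr oner_eq0.
Qed.

(* On T = y.1 the coordinate is -1 when y.2 guesses +1 and vice versa; off T it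
   is 0. The bit of index q.+1 has weight 1. *)
Definition guess_bits (n p q : nat) (y : {set 'I_n} * {set 'I_n}) : bitsvec n p q :=
  [ffun i => [ffun k => if unlift ord0 k is Some j then (i \in y.1) && (j == q :> nat)
                        else i \in y.2]].

Lemma vec_of_guess_bits (K : realType) (n p q : nat) (y : {set 'I_n} * {set 'I_n}) i :
  (0 < p)%N ->
  vec_of_bits K (guess_bits p q y) 0 i = (-1) ^+ (i \in y.2) * (i \in y.1)%:R.
Proof.
move=> p0; rewrite mxE /real_of_bits !ffunE unlift_none; congr (_ * _).
under eq_bigr => j _ do rewrite !ffunE liftK.
(* Having an integer bit makes the magnitude 1 representable, by the single bit [q] of weight 2^q /
   2^q. *)
have qpq : (q < p + q)%N by rewrite -[X in (X < _)%N]add0n ltn_add2r.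
rewrite (bigD1 (Ordinal qpq)) //= eqxx andbT big1 ?addn0; last first.
  by move=> j jq; rewrite -val_eqE /= in jq; rewrite (negPf jq) andbF.
by rewrite natrM natrX mulfK // expf_neq0 // pnatr_eq0.
Qed.

(** A correct guess opposes the sign in every coordinate of [T]. The value no longer mentions [u],
    so all oracles for which the guess is correct answer alike. *)
Lemma Fmax_agree (K : realType) (n p q : nat) (G : K) (u T S : {set 'I_n.+1}) :
  (0 < p)%N -> u :&: T = S ->
  Fmax G (sign_row K u) (vec_of_bits K (guess_bits p q (T, S))) =
  G * \big[Num.max/- (ord0 \in T)%:R]_i - (i \in T)%:R.
Proof.
move=> p0 <-; rewrite /Fmax.
have E i : sign_row K u 0 i * vec_of_bits K (guess_bits p q (T, u :&: T)) 0 i =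
           - (i \in T)%:R.
  rewrite vec_of_guess_bits // mxE /= inE.
  by case: (i \in u); case: (i \in T); rewrite /= ?(expr0, expr1); ring.
by rewrite E; under eq_bigr => i _ do rewrite E.
Qed.

(** A wrongly guessed coordinate of [T] contributes +1, the largest possible term. *)
Lemma Fmax_disagree (K : realType) (n p q : nat) (G : K) (u T S : {set 'I_n.+1}) :
  (0 < p)%N -> S \subset T -> u :&: T != S ->
  Fmax G (sign_row K u) (vec_of_bits K (guess_bits p q (T, S))) = G.
Proof.
move=> p0 ST uTS; rewrite /Fmax -[RHS]mulr1; congr (_ * _).
have E i : sign_row K u 0 i * vec_of_bits K (guess_bits p q (T, S)) 0 i =
           (-1) ^+ ((i \notin u) (+) (i \in S)) * (i \in T)%:R.
  by rewrite vec_of_guess_bits // mxE /= mulrA -signr_addb.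
have le1 i : (-1) ^+ ((i \notin u) (+) (i \in S)) * (i \in T)%:R <= 1 :> K.
  by case: (_ (+) _); case: (i \in T); rewrite /= ?(expr0, expr1); lra.
rewrite E; under eq_bigr => i _ do rewrite E.
apply/eqP; rewrite eq_le bigmax_le //=.
have [i iE] : exists i, (i \in u) && (i \in T) != (i \in S).
  apply/existsP; apply: contraNT uTS => /existsPn H; apply/eqP/setP => i.
  by have := H i; rewrite negbK inE => /eqP.
have iT : i \in T.
  apply: contraLR iE => iT; rewrite (negPf iT) andbF negbK.
  by rewrite (negPf (contra (subsetP ST i) iT)).
apply: le_trans (le_bigmax _ _ i); rewrite iT mulr1.
by rewrite iT andbT in iE; case: (i \in u) iE; case: (i \in S).
Qed.

Lemma Fmax_agree_le0 (K : realType) (n : nat) (G : K) (T : {set 'I_n.+1}) : 0 < G ->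
  G * \big[Num.max/- (ord0 \in T)%:R]_i - (i \in T)%:R <= 0.
Proof.
by move=> G0; rewrite pmulr_rle0 // bigmax_le // => *; rewrite oppr_le0.
Qed.

Lemma odd_divn_exp2_eq0 (k m : nat) : (m < 2 ^ k)%N ->
  (forall j, (j < k)%N -> ~~ odd (m %/ 2 ^ j)) -> m = 0%N.
Proof.
elim: k m => [|k IH] m; first by rewrite expn0 ltnS leqn0 => /eqP.
move=> mk Hodd; have := Hodd 0%N isT; rewrite expn0 divn1 => m_even.
have /IH : (m./2 < 2 ^ k)%N by rewrite -divn2 ltn_divLR // -expnSr.
have mE : m./2.*2 = m by rewrite even_halfK.
move=> H; rewrite -mE H // => j jk.
by have := Hodd j.+1 jk; rewrite expnS divnMA divn2.
Qed.

(** Equal sign bits would force [v = 0], whose magnitude bits all vanish, whereas [G] is at least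
    one unit of the last place and so has a nonzero bit, even after saturation. *)
Lemma bits_of_real_neq (K : realType) (p q : nat) (v G : K) :
  (0 < p)%N -> v <= 0 -> 1 <= G * 2 ^+ q ->
  bits_of_real p q v != bits_of_real p q G.
Proof.
move=> p0 v0 G1; have G0 : 0 < G.
  by rewrite -(pmulr_lgt0 _ (exprn_gt0 q (ltr0n K 2))) (lt_le_trans ltr01).
apply/eqP => /ffunP E.
have := E ord0; rewrite !ffunE unlift_none [G < 0]ltNge (ltW G0) /= => v_ge0.
have v_eq0 : v = 0 by apply/eqP; rewrite eq_le v0 leNgt v_ge0.
pose m := minn (Num.truncn (`|G| * 2 ^+ q)) (2 ^ (p + q)).-1.
have m_gt0 : (0 < m)%N.
  rewrite /m leq_min -subn1 subn_gt0.
  rewrite truncn_gt0 gtr0_norm // G1 /=.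
  by rewrite -[X in (X < _)%N](expn0 2) ltn_exp2l // addn_gt0 p0.
have m_lt : (m < 2 ^ (p + q))%N.
  by rewrite -[X in (_ < X)%N]prednK ?expn_gt0 // ltnS geq_minr.
suff /(odd_divn_exp2_eq0 m_lt) m0 : forall j, (j < p + q)%N -> ~~ odd (m %/ 2 ^ j).
  by rewrite m0 in m_gt0.
move=> j jpq; have := E (lift ord0 (Ordinal jpq)); rewrite !ffunE liftK /= -/m => <-.
by rewrite v_eq0 normr0 mul0r truncn0 min0n div0n.
Qed.

Lemma bits_of_real0 (K : realType) (p q : nat) :
  bits_of_real p q (0 : K) = [ffun=> false].
Proof.
apply/ffunP => k; rewrite !ffunE ltxx normr0 mul0r truncn0 min0n.
by case: (unlift ord0 k) => // j; rewrite div0n.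
Qed.

Lemma discretize_guess_eq (K : realType) (n p q : nat) (G : K) (u w : {set 'I_n.+1})
    (y : {set 'I_n.+1} * {set 'I_n.+1}) :
  (0 < p)%N -> 1 <= G * 2 ^+ q -> 0 < G -> y.2 \subset y.1 ->
  (discretize (Fmax G (sign_row K u)) (guess_bits p q y) !=
   discretize (Fmax G (sign_row K w)) (guess_bits p q y)) =
  ((u :&: y.1 == y.2) != (w :&: y.1 == y.2)).
Proof.
case: y => T S /= p0 G1 G0 ST; rewrite /discretize.
have neq := bits_of_real_neq p0 (Fmax_agree_le0 T G0) G1.
case: (eqVneq (u :&: T) S) => [uT|uT]; case: (eqVneq (w :&: T) S) => [wT|wT];
  rewrite ?(Fmax_agree _ _ p0 uT) ?(Fmax_agree _ _ p0 wT)
          ?(Fmax_disagree _ _ p0 ST uT) ?(Fmax_disagree _ _ p0 ST wT) ?eqxx //.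
by rewrite eq_sym neq.
Qed.

Lemma eps_optimal_sign_row (K : realType) (n : nat) (G R eps : K) (u : {set 'I_n.+1}) :
  0 < G -> 0 < R -> 0 < eps ->
  eps_optimal_on (l2ball R) (Fmax G (sign_row K u)) eps
    (- (R / Num.sqrt n.+1%:R) *: sign_row K u).
Proof.
move=> G0 R0 e0; set z := sign_row K u.
have zz i : z 0 i * z 0 i = 1 by rewrite mxE -expr2 sqrr_sign.
have s0 : 0 < Num.sqrt n.+1%:R :> K by rewrite sqrtr_gt0 ltr0n.
pose c := R / Num.sqrt n.+1%:R; have c0 : 0 < c by rewrite divr_gt0.
have c2 : c ^+ 2 *+ n.+1 = R ^+ 2.
  rewrite expr_div_n sqr_sqrtr // -mulr_natr divfK //.
  by rewrite pnatr_eq0.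
have yE i : (- c *: z) 0 i = - c * z 0 i by rewrite mxE.
have FE : Fmax G z (- c *: z) = G * - c.
  rewrite /Fmax; have E i : z 0 i * (- c *: z) 0 i = - c.
    by rewrite yE mulrCA zz mulr1.
  rewrite E; under eq_bigr => i _ do rewrite E.
  congr (_ * _); apply/eqP; rewrite eq_le bigmax_le //=.
  exact: (le_bigmax _ (fun=> - c) ord0).
have inB : l2ball R (- c *: z).
  rewrite /l2ball /l2norm /=.
  under eq_bigr => i _ do rewrite yE exprMn sqrrN [z 0 i ^+ 2]zz mulr1.
  by rewrite sumr_const card_ord c2 sqrtr_sqr gtr0_norm.
split => //; exists (G * - c); last by rewrite FE subrr ltW.
split; first by exists (- c *: z).
move=> y yB; rewrite ler_pM2l //.
(* If every [z 0 i * y 0 i] were below [- c], every squared coordinate would exceed [c ^+ 2] and [y]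
   would leave the ball. *)
have [i yi] : exists i, - c <= z 0 i * y 0 i.
  apply/existsP; apply: contraT => /existsPn H.
  suff : R ^+ 2 < \sum_i y 0 i ^+ 2.
    rewrite ltNge => /negP[]; move: yB; rewrite /l2ball /l2norm /= => yB.
    have S0 : 0 <= \sum_i y 0 i ^+ 2 by apply: sumr_ge0 => i _; rewrite sqr_ge0.
    by rewrite -(sqr_sqrtr S0) ler_sqr // nnegrE ?sqrtr_ge0 // ltW.
  rewrite -c2 -[n.+1 in X in X < _]card_ord -sumr_const.
  apply: ltr_sum => [|i _]; first by apply/hasP; exists ord0; rewrite ?mem_index_enum.
  have := H i; rewrite -ltNge => yi.
  have -> : y 0 i ^+ 2 = (z 0 i * y 0 i) ^+ 2 by rewrite exprMn [z 0 i ^+ 2]zz mul1r.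
  by nra.
apply: le_trans yi _.
exact: (le_bigmax _ (fun i => z 0 i * y 0 i)).
Qed.

(** * Choice of the constants and assembly of the algorithm *)

Unset Implicit Arguments.

Theorem theorem1p4 (K : realType) (delta : K) (hdelta : 0 < delta < 1) :
  exists2 C : K, 0 < C &
  forall (G R eps : K) (n : nat),
    0 < G -> 0 < R -> 0 < eps ->
    Num.floor (9 / 10 * (G * R / eps) ^+ 2) = n.+1%:Z ->
  exists b0 : nat, forall p q : nat, (b0 <= p)%N -> (b0 <= q)%N ->
  exists A : query_algorithm K (bitsvec n.+1 p q) (p + q).+1 'rV[K]_n.+1,
    (qa_queries A)%:R <= C * (G * R / eps) /\
    forall z : 'rV[K]_n.+1, is_sign_vector z ->
      1 - delta <= qa_prob A (@discretize K n.+1 p q (Fmax G z))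
                     (eps_optimal_on (l2ball R) (Fmax G z) eps).
Proof.
have /andP[d0 d1] := hdelta.
have d2 : 0 < 8 / delta ^+ 2 by rewrite divr_gt0 // exprn_gt0.
(* Error [delta] requires a squared witness norm of at most [(delta / 2) ^+ 2 * T]. That norm is at
   most 2 GR/eps, whence 8 / delta^2; the extra 1 absorbs rounding [T] up, as GR/eps >= 1. *)
exists (8 / delta ^+ 2 + 1); first by rewrite addr_gt0.
move=> G R eps n G0 R0 e0 nE; set a := G * R / eps in nE *.
have a0 : 0 < a by rewrite divr_gt0 // mulr_gt0.
have na : n.+1%:R <= a ^+ 2.
  have := floor_le (9 / 10 * a ^+ 2); rewrite nE -pmulrn => na.
  by have := sqr_ge0 a; lra.
have a1 : 1 <= a.
  have : 1 <= a ^+ 2 by apply: le_trans na; rewrite ler1n.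
  by nra.
have sn : Num.sqrt n.+1%:R <= a.
  by rewrite -[X in _ <= X]gtr0_norm // -sqrtr_sqr ler_wsqrtr.
(* With this many fractional bits 2^q >= 1/G, so the value [G] does not round to zero; the successor
   also guarantees an integer bit. *)
exists (Num.truncn G^-1).+1 => p q bp bq.
have p0 : (0 < p)%N by apply: leq_trans bp.
have G1 : 1 <= G * 2 ^+ q.
  rewrite -ler_pdivrMl // mulr1; apply: le_trans (ltW (truncnS_gt _)) _.
  by rewrite -natrX ler_nat (leq_trans bq) // ltnW // ltn_expl.
pose T := (Num.truncn (8 / delta ^+ 2 * a)).+1.
have T0 : 0 < T%:R :> K by rewrite ltr0n.
(* The neutral query [x0] is the empty guess: it encodes the origin, where every [Fmax] vanishes. *)
have [||A [AT AP]] := @catalyst_algorithm K _ _ _ _ (guess_bits p q (set0, set0))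
  (guess_bits p q) (fun u => discretize (Fmax G (sign_row K u)))
  (@witness K n.+1) T isT _ _ _ (fun u => - (R / Num.sqrt n.+1%:R) *: sign_row K u) 0.
- move=> u; rewrite /discretize (Fmax_agree _ _ p0) ?setI0 //.
  rewrite -[RHS](bits_of_real0 K); congr bits_of_real.
  rewrite in_set0 oppr0 (big_ind (fun x : K => x = 0)) ?mulr0 //.
    by move=> _ _ -> ->; rewrite maxxx.
  by move=> i _; rewrite in_set0 oppr0.
- by move=> u w; apply: witness_dot => y yS; rewrite discretize_guess_eq.
exists A; split.
  rewrite AT.
  have -> : T%:R = (Num.truncn (8 / delta ^+ 2 * a))%:R + 1 :> K by rewrite natr1.
  rewrite [X in _ <= X]mulrDl mul1r lerD // truncn_le.
  by rewrite mulr_ge0 // ltW.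
move=> z /sign_vectorP[u ->].
apply: le_trans (AP u _ (eps_optimal_sign_row u G0 R0 e0)).
rewrite lerD2l lerN2.
have vn := witness_norm K u.
have vT : (\sum_y witness K u y ^+ 2) / T%:R <= (delta / 2) ^+ 2.
  rewrite ler_pdivrMr //; apply: le_trans vn _.
  have := ltW (truncnS_gt (8 / delta ^+ 2 * a)); rewrite -/T => Ta.
  have -> : 2 * Num.sqrt n.+1%:R = delta ^+ 2 / 4 * (8 / delta ^+ 2 * Num.sqrt n.+1%:R).
    by field; rewrite gt_eqF.
  rewrite expr_div_n -natrX; apply: ler_wpM2l; first by rewrite divr_ge0 // sqr_ge0.
  by apply: le_trans Ta; rewrite ler_wpM2l // ltW.
have := ler_wsqrtr vT; rewrite sqrtr_sqr gtr0_norm; first lra.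
by rewrite divr_gt0.
Qed.
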